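(* Let $k\ge 2$ be an integer. If the first double modes of the Poisson distribution of order $k$ are located at $0$ and $m$ (that is, $m>0$ is an integer such that $0$ and $m$ are both modes of the Poisson distribution of order $k$ with parameter $\lambda=\hat\lambda_k$), then $m\ge k$. This lower bound is sharp, i.e. there is some $k\ge2$ for which the equality $m=k$ is attained.
   Context: For an integer $k\ge1$ and a real $\lambda>0$, the Poisson distribution of order $k$ with parameter $\lambda$ is the distribution on $\{0,1,2,\dots\}$ with probability mass function $$f_k(n;\lambda)=e^{-k\lambda}\sum_{n_1+2n_2+\dots+kn_k=n}\frac{\lambda^{n_1+\dots+n_k}}{n_1!\cdots n_k!},\qquad n=0,1,2,\dots,$$ where the sum is over all tuples $(n_1,\dots,n_k)$ of nonnegative integers with $n_1+2n_2+\dots+kn_k=n$. A mode is a location of a global maximum of $n\mapsto f_k(n;\lambda)$ over $n\ge0$; modes need not be unique. The first double mode refers to the smallest value of $\lambda>0$, denoted $\hat\lambda_k$, for which $0$ and some integer $m>0$ are both modes of the Poisson distribution of order $k$ with parameter $\lambda$. The possibility that there are further modes at $\lambda=\hat\lambda_k$ is not excluded by the definition. *)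

(* Defs.v *)
From mathcomp Require Import all_boot all_order all_algebra.
From mathcomp Require Import reals sequences exp.

Set Implicit Arguments.
Unset Strict Implicit.
Unset Printing Implicit Defensive.

Import Order.TTheory GRing.Theory Num.Theory.
Local Open Scope ring_scope.

(* The index i : 'I_k is zero-based: [t i] is the multiplicity n_(i+1), of
   weight i+1.  Restricting its values to 'I_n.+1 loses no tuple, since
   n_1 + 2 n_2 + ... + k n_k = n forces every n_j <= n. *)
Definition poisson_order_pmf (R : realType) (k : nat) (lambda : R) (n : nat) : R :=
  expR (- (k%:R * lambda)) *
  \sum_(t : {ffun 'I_k -> 'I_n.+1} | (\sum_(i < k) i.+1 * t i == n)%N)
     lambda ^+ (\sum_(i < k) t i)%N / (\prod_(i < k) (t i)`!)%N%:R.

Definition is_mode (R : realType) (k : nat) (lambda : R) (m : nat) : Prop :=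
  forall n : nat, poisson_order_pmf k lambda n <= poisson_order_pmf k lambda m.

Definition double_mode_at_zero (R : realType) (k : nat) (lambda : R) : Prop :=
  is_mode k lambda 0 /\ exists m : nat, (0 < m)%N /\ is_mode k lambda m.

Definition is_first_double_mode (R : realType) (k : nat) (lambda : R) : Prop :=
  [/\ 0 < lambda, double_mode_at_zero k lambda &
      forall mu : R, 0 < mu -> double_mode_at_zero k mu -> lambda <= mu].

(* Main.v *)
(* Up to the factor [exp (- k lambda)], the mass at [n] is the coefficient [h n] of [z ^ n] in
   [exp (lambda (z + ... + z ^ k))], and differentiating this series gives
   [n h_n = lambda (h_(n-1) + 2 h_(n-2) + ... + k h_(n-k))].  For [0 < n < k] the recursion
   yields [h_n <= lambda (h_0 + ... + h_(n-1))], and subtracting its instances at [n+1] and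
   [n] then gives [h_n < h_(n+1)], so no mode lies in [0 < n < k].
   Sharpness is attained at [k = 2] and [lambda = sqrt 3 - 1], the positive root of [h_2 = 1]:
   for [lambda < 1] the recursion gives [h_n <= lambda] for all [n >= 3] as soon as
   [h_1, h_2 <= 1]. *)
Require Import Defs.
From mathcomp Require Import all_boot all_order all_algebra.
From mathcomp Require Import reals sequences exp.
From mathcomp Require Import ring lra zify.

Set Implicit Arguments.
Unset Strict Implicit.
Unset Printing Implicit Defensive.

Import Order.TTheory GRing.Theory Num.Theory.
Local Open Scope ring_scope.

Section Coefficients.
Variables (R : realType) (k : nat) (lambda : R).

(** Taken on plain functions rather than on bounded finite ones, so that adding one part to a tuple
    needs no range check and tuples with different bounds can be compared. *)
Definition weight (f : 'I_k -> nat) : nat := (\sum_(i < k) i.+1 * f i)%N.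

Definition poisson_term (f : 'I_k -> nat) : R :=
  lambda ^+ (\sum_(i < k) f i)%N / (\prod_(i < k) (f i)`!)%N%:R.

Definition poisson_coef (n : nat) : R :=
  \sum_(t : {ffun 'I_k -> 'I_n.+1} | weight (fun i => t i) == n)
     poisson_term (fun i => t i).

Lemma pmf_coef n :
  poisson_order_pmf k lambda n = expR (- (k%:R * lambda)) * poisson_coef n.
Proof. by []. Qed.

Lemma eq_weight (f g : 'I_k -> nat) : f =1 g -> weight f = weight g.
Proof. by move=> fg; apply: eq_bigr => i _; rewrite fg. Qed.

Lemma eq_poisson_term (f g : 'I_k -> nat) :
  f =1 g -> poisson_term f = poisson_term g.
Proof.
move=> fg; rewrite /poisson_term.
by congr (_ ^+ _ / _%:R); apply: eq_bigr => i _; rewrite fg.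
Qed.

Lemma leq_weight (f : 'I_k -> nat) (i : 'I_k) : (i.+1 * f i <= weight f)%N.
Proof. by rewrite /weight (bigD1 i) //= leq_addr. Qed.

Lemma weight_incr (f : 'I_k -> nat) i :
  weight (fun j => f j + (j == i))%N = (weight f + i.+1)%N.
Proof.
rewrite /weight (bigD1 i) //= [in RHS](bigD1 i) //= eqxx.
rewrite (eq_bigr (fun j : 'I_k => j.+1 * f j)%N).
  by lia.
by move=> j /negbTE ->; rewrite addn0.
Qed.

(** One more part of size [i.+1] contributes one more factor [lambda] and multiplies the factorials
    by [(f i).+1]. *)
Lemma poisson_term_incr (f : 'I_k -> nat) i :
  (f i).+1%:R * poisson_term (fun j => f j + (j == i))%N
    = lambda * poisson_term f.
Proof.
rewrite /poisson_term.
have -> : (\sum_(j < k) (f j + (j == i)) = (\sum_(j < k) f j).+1)%N.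
  rewrite big_split /= (bigD1 i) //= (bigD1 (P := xpredT) i) //= eqxx.
  by rewrite [X in (_ + (_ + X))%N]big1 => [|j /negbTE ->]; lia.
have -> : (\prod_(j < k) (f j + (j == i))`!
           = (f i).+1 * \prod_(j < k) (f j)`!)%N.
  rewrite (bigD1 i) //= [in RHS](bigD1 i) //= eqxx addn1 factS.
  rewrite (eq_bigr (fun j : 'I_k => (f j)`!)); first by rewrite mulnA.
  by move=> j /negbTE ->; rewrite addn0.
have prod_neq0 : (\prod_(j < k) (f j)`!)%N%:R != 0 :> R.
  by rewrite pnatr_eq0 -lt0n prodn_gt0 // => j; rewrite fact_gt0.
by rewrite natrM exprS; field; rewrite prod_neq0 nat1r pnatr_eq0.
Qed.

(** The factor [t i] kills the tuples without a part of size [i.+1]; on the others, removing one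
    such part is a bijection onto the tuples of weight [n - i.+1]. *)
Lemma sum_multiplicity n (i : 'I_k) : (i < n)%N ->
  \sum_(t : {ffun 'I_k -> 'I_n.+1} | weight (fun j => t j) == n)
     (t i)%:R * poisson_term (fun j => t j) = lambda * poisson_coef (n - i.+1).
Proof.
move=> lt_in; set m := (n - i.+1)%N.
rewrite (bigID (fun t : {ffun 'I_k -> 'I_n.+1} => 0 < t i)%N) /=.
rewrite [X in _ + X]big1 ?addr0; last first.
  by move=> t /andP[_]; rewrite -eqn0Ngt => /eqP ->; rewrite mul0r.
pose up (s : {ffun 'I_k -> 'I_m.+1}) : {ffun 'I_k -> 'I_n.+1} :=
  [ffun j => inord (s j + (j == i))].
pose down (t : {ffun 'I_k -> 'I_n.+1}) : {ffun 'I_k -> 'I_m.+1} :=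
  [ffun j => inord (t j - (j == i))].
have upE s j : up s j = (s j + (j == i))%N :> nat.
  by rewrite ffunE inordK //; have := ltn_ord (s j); lia.
have weight_up s : weight (fun j => up s j) = (weight (fun j => s j) + i.+1)%N.
  by rewrite -weight_incr; apply: eq_weight => j; rewrite upE.
(* [inord] is faithful only in range: after the removal the weight is [m], and each multiplicity is
   at most the weight. *)
have downE (t : {ffun 'I_k -> 'I_n.+1}) : weight (fun j => t j) == n ->
    (0 < t i)%N -> forall j, down t j = (t j - (j == i))%N :> nat.
  move=> /eqP wt ti j; rewrite ffunE inordK // ltnS.
  have tE : (fun j => t j - (j == i) + (j == i))%N =1 (fun j => t j : nat).
    by move=> l; case: eqP => [->|_]; lia.
  have := weight_incr (fun j => t j - (j == i))%N i.
  rewrite (eq_weight tE) wt => nE.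
  have -> : m = weight (fun j => t j - (j == i))%N by rewrite /m; lia.
  apply: leq_trans (leq_weight (fun j => t j - (j == i))%N j).
  exact: leq_pmull.
rewrite (reindex_onto up down) /=; last first.
  move=> t /andP[wt ti]; apply/ffunP => j; apply: val_inj => /=.
  by rewrite upE downE //; case: eqP => [->|_]; lia.
rewrite /poisson_coef mulr_sumr; apply: eq_big => [s|s _].
  rewrite weight_up upE eqxx addn1 /= andbT.
  have -> : (weight (fun j => s j) + i.+1 == n)%N = (weight (fun j => s j) == m).
    by rewrite /m; lia.
  case: eqP => //= ws; apply/eqP/ffunP => j; apply: val_inj => /=.
  by rewrite downE ?weight_up ?ws ?upE ?eqxx /m; lia.
rewrite -(poisson_term_incr _ i) upE eqxx addn1; congr (_ * _).
by apply: eq_poisson_term => j; rewrite upE.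
Qed.

(** Replace [n] by the weight of each tuple and exchange the sums. The guard [i < n] keeps the
    truncated [n - i.+1] from producing spurious copies of [poisson_coef 0]. *)
Lemma poisson_coef_rec n :
  n%:R * poisson_coef n
    = lambda * \sum_(i < k | (i < n)%N) i.+1%:R * poisson_coef (n - i.+1).
Proof.
rewrite {2}/poisson_coef mulr_sumr.
transitivity (\sum_(i < k) \sum_(t : {ffun 'I_k -> 'I_n.+1}
    | weight (fun j => t j) == n) i.+1%:R * ((t i)%:R * poisson_term (fun j => t j))).
  rewrite exchange_big /=; apply: eq_bigr => t /eqP wt.
  rewrite -{1}wt natr_sum mulr_suml.
  by apply: eq_bigr => i _; rewrite natrM mulrA.
rewrite mulr_sumr [RHS]big_mkcond; apply: eq_bigr => i _.
rewrite -mulr_sumr; case: ifP => [lt_in|ge_in].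
  by rewrite sum_multiplicity // mulrCA.
rewrite big1 ?mulr0 // => t /eqP wt.
(* Here [n <= i], so a single part of size [i.+1] would already exceed the weight [n]. *)
have := leq_weight (fun j => t j) i; rewrite wt => le_n.
by have -> : (t i = 0 :> nat)%N by [nia]; rewrite mul0r.
Qed.

Lemma poisson_coef0 : poisson_coef 0 = 1.
Proof.
rewrite /poisson_coef (big_pred1 [ffun=> ord0]) => [|t].
  rewrite /poisson_term !big1 => [|i _|i _]; last 2 first.
  - by rewrite ffunE.
  - by rewrite ffunE.
  by rewrite expr0 divr1.
have -> : t = [ffun=> ord0] by apply/ffunP => i; rewrite ffunE ord1.
by rewrite /= eqxx /weight big1 // => i _; rewrite ffunE muln0.
Qed.

Lemma poisson_coef_ge0 n : 0 <= lambda -> 0 <= poisson_coef n.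
Proof.
by move=> l0; apply: sumr_ge0 => t _; rewrite divr_ge0 ?exprn_ge0 ?ler0n.
Qed.

Lemma is_modeP m :
  is_mode k lambda m <-> forall n, poisson_coef n <= poisson_coef m.
Proof.
by split=> mode_m n; have := mode_m n; rewrite !pmf_coef ler_pM2l ?expR_gt0.
Qed.

(** For [n <= k] the recursion reaches all earlier coefficients. Reversing the index aligns the
    summands of consecutive instances, whose weights then differ by 1. *)
Lemma poisson_coef_rec_small n : (n <= k)%N ->
  n%:R * poisson_coef n = lambda * \sum_(i < n) (n - i)%:R * poisson_coef i.
Proof.
move=> le_nk; rewrite poisson_coef_rec; congr (_ * _).
rewrite -(big_ord_widen _ (fun i => i.+1%:R * poisson_coef (n - i.+1))) //.
rewrite (reindex_inj rev_ord_inj) /=; apply: eq_bigr => i _.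
by have lt_in := ltn_ord i; rewrite subnSK // subKn // ltnW.
Qed.

Lemma poisson_coef_lt n : 0 < lambda -> (0 < n < k)%N ->
  poisson_coef n < poisson_coef n.+1.
Proof.
move=> l0 /andP[n0 lt_nk].
have h0 i : 0 <= poisson_coef i by apply: poisson_coef_ge0; exact: ltW.
set S := \sum_(i < n) poisson_coef i.
have S0 : 0 < S.
  rewrite /S -(prednK n0) big_ord_recl poisson_coef0.
  by rewrite ltr_pwDl // sumr_ge0.
have recn := poisson_coef_rec_small (ltnW lt_nk).
have recSn := poisson_coef_rec_small lt_nk.
have ub : poisson_coef n <= lambda * S.
  rewrite -(ler_pM2l (_ : 0 < n%:R)) ?ltr0n // recn mulrCA ler_pM2l //.
  rewrite mulr_sumr ler_sum // => i _.
  by rewrite ler_wpM2r // ler_nat leq_subr.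
have hn : 0 < poisson_coef n.
  rewrite -(pmulr_rgt0 _ (_ : 0 < n%:R)) ?ltr0n // recn mulr_gt0 //.
  rewrite (lt_le_trans S0) // ler_sum // => i _.
  by rewrite ler_peMl // ler1n subn_gt0.
have diff : n.+1%:R * poisson_coef n.+1
    = n%:R * poisson_coef n + lambda * (S + poisson_coef n).
  rewrite recSn recn -mulrDr big_ord_recr /= subSnn mul1r addrA; congr (_ * (_ + _)).
  rewrite -big_split /=; apply: eq_bigr => i _.
  by rewrite subSn 1?ltnW // -natr1 mulrDl mul1r.
(* By [ub], [lambda * S] supplies the missing copy of the coefficient at [n]; the remaining [lambda]
   times that coefficient makes the inequality strict. *)
rewrite -(ltr_pM2l (_ : 0 < n.+1%:R)) ?ltr0n // diff -natr1.
by have := mulr_gt0 l0 hn; lra.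
Qed.

End Coefficients.

Section OrderTwo.
Variables (R : realType) (lambda : R).
Local Notation h := (poisson_coef 2 lambda).

Lemma poisson_coef_two1 : h 1 = lambda.
Proof.
have := poisson_coef_rec_small lambda (isT : 1 <= 2)%N.
by rewrite big_ord1 poisson_coef0 subn0 !mul1r mulr1.
Qed.

Lemma poisson_coef_two2 : h 2 = lambda + lambda ^+ 2 / 2.
Proof.
have := poisson_coef_rec_small lambda (isT : 2 <= 2)%N.
rewrite big_ord_recr big_ord1 /= poisson_coef0 poisson_coef_two1 subn0 subn1 /=.
by lra.
Qed.

(** If the two preceding coefficients are at most 1, the recursion gives [n * h n <= 3 * lambda],
    and [3 <= n]. *)
Lemma poisson_coef_two_le n :
  0 < lambda -> lambda < 1 -> h 2 <= 1 -> (2 < n)%N -> h n <= lambda.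
Proof.
move=> l0 l1 h2.
(* A window of three values carries the induction: [lambda < 1] turns the last bound into a bound by
   1 for the next window. *)
suff bound : forall n, h n.+1 <= 1 /\ h n.+2 <= 1 /\ h n.+3 <= lambda.
  by case: n => [|[|[|n]]] // _; case: (bound n) => _ [].
have step j : h j.+1 <= 1 -> h j.+2 <= 1 -> h j.+3 <= lambda.
  move=> hj hj'; have := poisson_coef_rec 2 lambda j.+3.
  rewrite big_mkcond big_ord_recr big_ord1 /= !subSS !subn0 => rec.
  rewrite -(ler_pM2l (_ : 0 < j.+3%:R)) ?ltr0n // rec.
  have -> : j.+3%:R = 3 + j%:R :> R by rewrite -natrD.
  by have := ler0n R j; nra.
elim=> [|j [_ [hj hj']]].
  have h1 : h 1 <= 1 by rewrite poisson_coef_two1 ltW.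
  by do 2?split=> //; apply: step.
have hj1 : h j.+3 <= 1 by lra.
by do 2?split=> //; apply: step.
Qed.

End OrderTwo.

Theorem proposition4p1 (R : realType) :
  (forall (k : nat) (lambda : R) (m : nat),
      (2 <= k)%N ->
      is_first_double_mode k lambda ->
      (0 < m)%N ->
      is_mode k lambda 0 ->
      is_mode k lambda m ->
      (k <= m)%N) /\
  (exists (k : nat) (lambda : R),
      [/\ (2 <= k)%N,
          is_first_double_mode k lambda,
          is_mode k lambda 0 &
          is_mode k lambda k]).
Proof.
split=> [k lambda m _ [l0 _ _] m0 _ /is_modeP mode_m|].
  rewrite leqNgt; apply/negP => lt_mk.
  by have := mode_m m.+1; rewrite leNgt poisson_coef_lt // m0.
have sq3 : Num.sqrt 3 ^+ 2 = 3 :> R by rewrite sqr_sqrtr.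
have sq3_ge0 : 0 <= Num.sqrt 3 :> R by exact: sqrtr_ge0.
pose lambda : R := Num.sqrt 3 - 1.
have l0 : 0 < lambda by rewrite /lambda; nra.
have l1 : lambda < 1 by rewrite /lambda; nra.
have h2 : poisson_coef 2 lambda 2 = 1.
  by rewrite poisson_coef_two2 /lambda; nra.
have le1 n : poisson_coef 2 lambda n <= 1.
  case: n => [|[|[|n]]]; rewrite ?poisson_coef0 ?poisson_coef_two1 ?h2 //.
    exact: ltW.
  by rewrite (le_trans _ (ltW l1)) // poisson_coef_two_le ?h2.
have mode0 : is_mode 2 lambda 0 by apply/is_modeP => n; rewrite poisson_coef0.
have mode2 : is_mode 2 lambda 2 by apply/is_modeP => n; rewrite h2.
exists 2, lambda; split=> //; split=> //; first by split=> //; exists 2.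
move=> mu mu0 [/is_modeP mode_mu0 [m [m0 /is_modeP mode_mum]]].
(* For [mu < lambda], a mode [m > 0] needs a coefficient of at least 1, the value at 0; but those at
   1, 2 and beyond are all below 1. *)
rewrite leNgt; apply/negP => mu_lt.
have hm1 : 1 <= poisson_coef 2 mu m by rewrite -(poisson_coef0 2 mu).
have hmu2 : poisson_coef 2 mu 2 < 1.
  by rewrite -h2 !poisson_coef_two2; nra.
case: m m0 hm1 {mode_mum} => [|[|[|m]]] // _.
- by rewrite poisson_coef_two1; lra.
- by lra.
have := poisson_coef_two_le mu0 (lt_trans mu_lt l1) (ltW hmu2) (isT : 2 < m.+3)%N.
by lra.
Qed.
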